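(* For every $l\ge1$ and $n\ge 2l$: $N_{2l}(n)\le n(n-2l)$ and $A_{2l}(n)\le n-2l+1$.
   Context: There are $n$ balls, each colored red or blue in an unknown way. A ball $b$ is a majority ball of a set $A$ if more than $|A|/2$ balls of $A$ have the color of $b$, and a non-minority ball of $A$ if at least $|A|/2$ balls of $A$ have the color of $b$. A query is a set of $q$ balls; the answer is either (the index of) a majority ball of the query, chosen adversarially, or, if the query has no majority ball, the statement that there is no majority ball in it. The goal is to name a ball guaranteed to be a non-minority ball of the whole set, i.e. non-minority in every coloring consistent with the answers. $A_q(n)$ (resp. $N_q(n)$) is the minimum worst-case number of queries needed when queries may be chosen adaptively (resp. must all be fixed in advance).
   Formalization: The bound on N_{2l}(n) is stated only for l = 1 or n > 2l: for n = 2l and l ≥ 2 it would claim that no query is needed, which is false, since the named ball could be the only one of its color. *)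

(* Defs.v *)
From mathcomp Require Import all_boot.

Set Implicit Arguments.
Unset Strict Implicit.
Unset Printing Implicit Defensive.

Definition coloring (n : nat) : Type := {ffun 'I_n -> bool}.

Definition same_color n (c : coloring n) (S : {set 'I_n}) (b : 'I_n) : {set 'I_n} :=
  [set x in S | c x == c b].

Definition majority n (c : coloring n) (S : {set 'I_n}) (b : 'I_n) : bool :=
  (b \in S) && (#|S| < 2 * #|same_color c S b|).

Definition nonminority n (c : coloring n) (S : {set 'I_n}) (b : 'I_n) : bool :=
  (b \in S) && (#|S| <= 2 * #|same_color c S b|).

(* [None] is the answer "there is no majority ball in the query". *)
Definition answer (n : nat) : Type := option 'I_n.

Definition valid_answer n (c : coloring n) (Q : {set 'I_n}) (a : answer n) : Prop :=
  if a is Some b then majority c Q b else forall b, ~~ majority c Q b.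

Inductive strategy (n : nat) : Type :=
  | Output of 'I_n
  | Query of {set 'I_n} & (answer n -> strategy n).

Fixpoint queries_of_size n (q : nat) (s : strategy n) : Prop :=
  if s is Query Q next
  then #|Q| = q /\ forall a, queries_of_size q (next a)
  else True.

(* [run c s k b]: against the hidden coloring [c], some sequence of valid
   (adversarially chosen) answers leads [s] to name [b] after [k] queries. *)
Inductive run n (c : coloring n) : strategy n -> nat -> 'I_n -> Prop :=
  | run_output b : run c (Output b) 0 b
  | run_query Q next a k b :
      valid_answer c Q a -> run c (next a) k b -> run c (Query Q next) k.+1 b.

Definition adaptive_solvable (q n k : nat) : Prop :=
  exists2 s : strategy n, queries_of_size q s &
    forall (c : coloring n) m b, run c s m b -> nonminority c [set: 'I_n] b /\ m <= k.

Definition nonadaptive_solvable (q n k : nat) : Prop :=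
  exists2 Q : 'I_k -> {set 'I_n}, (forall i, #|Q i| = q) &
    forall a : 'I_k -> answer n, exists b : 'I_n,
      forall c : coloring n, (forall i, valid_answer c (Q i) (a i)) ->
        nonminority c [set: 'I_n] b.

Definition is_minimum (P : nat -> Prop) (k : nat) : Prop :=
  P k /\ forall m, P m -> k <= m.

(* A_q(n) and N_q(n) are given as relations rather than as total functions, so
   that no default value is involved when the problem cannot be solved. *)
Definition is_A (q n a : nat) : Prop := is_minimum (adaptive_solvable q n) a.

Definition is_N (q n k : nat) : Prop := is_minimum (nonadaptive_solvable q n) k.

(* Main.v *)
(** Exchange argument: if [Q] has a majority and loses a ball of that color,
    then after adding one new ball it is either balanced or still has a majority
    of the same color.  If [Q] is balanced and contains [x], then querying
    [Q - x + y] tells whether [x] and [y] have the same color, so [n - 2l]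
    further queries reveal all colors outside [Q] relative to [x].

    Adaptively, keep replacing the ball named by the answer with an unseen one:
    either no query is ever balanced and all named balls have the majority
    color, or some query is balanced and each unseen ball is compared with the
    ball added last, whose color is opposite to that of the discarded balls.

    Non-adaptively, put the balls on a circle and query, for every arc of [2l]
    balls, all sets obtained by replacing its first ball with a ball outside.
    Every arc is itself such a set.  If some arc is balanced, all colors outside
    it are known; otherwise consecutive arcs, hence all arcs, have the same
    majority color, and averaging over the arcs makes it the global one. *)
From Stdlib Require Import Classical.
Require Import Defs.
From mathcomp Require Import all_boot zify.

Set Implicit Arguments.
Unset Strict Implicit.
Unset Printing Implicit Defensive.

(** Reduces both bounds to exhibiting one solution with the stated number of queries. [P] may be
    undecidable, hence the classical case split. *)
Lemma exists_is_minimum (P : nat -> Prop) (K : nat) :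
  P K -> exists2 k, is_minimum P k & k <= K.
Proof.
elim/ltn_ind: K => K IH PK.
have [[m [Pm ltmK]]|noP] := classic (exists m, P m /\ m < K).
  have [k mink lekm] := IH m ltmK Pm.
  by exists k => //; lia.
exists K => //; split=> // m Pm; rewrite leqNgt; apply/negP => ltmK.
by apply: noP; exists m.
Qed.

(** * Color counts and valid answers *)

Definition num_colored n (c : coloring n) (S : {set 'I_n}) (col : bool) : nat :=
  #|[set x in S | c x == col]|.

Section Counting.

Variables (n : nat) (c : coloring n).
Implicit Types (S : {set 'I_n}) (x b : 'I_n) (col : bool).

Lemma num_coloredE S col : num_colored c S col = \sum_(x in S) (c x == col).
Proof.
by rewrite /num_colored -sum1dep_card big_mkcondr; apply: eq_bigr => x _; case: eqP.
Qed.

Lemma num_coloredC S col : num_colored c S col + num_colored c S (~~ col) = #|S|.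
Proof.
rewrite !num_coloredE -big_split -sum1_card; apply: eq_bigr => x _ /=.
by case: (c x); case: col.
Qed.

(** Pigeonhole; it serves for the [2l-1] balls left when one ball leaves a query. *)
Lemma exists_num_colored_ge S l :
  2 * l <= #|S|.+1 -> exists col, l <= num_colored c S col.
Proof.
rewrite -(num_coloredC S true) /= => leS.
by have [|lt] := leqP l (num_colored c S true); [exists true | exists false; lia].
Qed.

Lemma num_colored_setU1 S x col :
  x \notin S -> num_colored c (x |: S) col = (c x == col) + num_colored c S col.
Proof. by move=> xS; rewrite !num_coloredE big_setU1. Qed.

Lemma num_colored_setD1 S x col :
  x \in S -> num_colored c S col = (c x == col) + num_colored c (S :\ x) col.
Proof. by move=> xS; rewrite !num_coloredE (big_setD1 x). Qed.

Lemma majorityP S b :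
  majority c S b -> b \in S /\ #|S| < 2 * num_colored c S (c b).
Proof. by case/andP. Qed.

Lemma nonminority_setT b :
  nonminority c [set: 'I_n] b = (n <= 2 * num_colored c [set: 'I_n] (c b)).
Proof. by rewrite /nonminority inE /= cardsT card_ord. Qed.

Lemma no_majority_num_colored S col :
  valid_answer c S None -> 2 * num_colored c S col <= #|S|.
Proof.
move=> noS; rewrite leqNgt; apply/negP => ltS.
have /card_gt0P[x]: 0 < num_colored c S col by lia.
rewrite inE => /andP[xS /eqP cx].
by have /negP := noS x; apply; rewrite /majority xS /same_color cx.
Qed.

Lemma balanced_num_colored l S col :
  #|S| = 2 * l -> valid_answer c S None -> num_colored c S col = l.
Proof.
move=> cardS noS; have := num_coloredC S col.
have := no_majority_num_colored col noS.
have := no_majority_num_colored (~~ col) noS.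
lia.
Qed.

(** Removing [x] from a balanced set leaves [l-1] balls of its color and [l] of the other. Adding
    [y] thus restores balance exactly when [y] has the color of [x]; otherwise the counts are [l-1]
    and [l+1]. *)
Lemma valid_answer_swap l S x y a :
  #|S| = 2 * l -> valid_answer c S None -> x \in S -> y \notin S ->
  valid_answer c (y |: S :\ x) a -> (c y == c x) = (a == None).
Proof.
move=> cardS noS xS yS.
have ySx : y \notin S :\ x by rewrite !inE (negPf yS) andbF.
have := balanced_num_colored true cardS noS.
have := balanced_num_colored false cardS noS.
have cardS' : #|y |: S :\ x| = 2 * l.
  by move: (cardsD1 x S); rewrite cardsU1 ySx xS cardS.
rewrite !(num_colored_setD1 _ xS) => nf nt.
case: a => [b|]; last first.
  move=> noS'; have := balanced_num_colored true cardS' noS'.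
  rewrite num_colored_setU1 // eqxx; move: nf nt; case: (c x); case: (c y) => /=; lia.
rewrite [RHS](_ : _ = false) //; case/majorityP => _; rewrite cardS' num_colored_setU1 //.
by move: nf nt; case: (c x); case: (c y); case: (c b) => /=; lia.
Qed.

End Counting.

(* Inside [S] the colors cancel, so the decision depends only on the set [E] of
   the outside balls that have the color of [x]. *)
Lemma balanced_nonminority n l (S E : {set 'I_n}) (x : 'I_n) :
  #|S| = 2 * l -> x \in S ->
  exists b, forall c : coloring n, valid_answer c S None ->
    (forall y, y \notin S -> (c y == c x) = (y \in E)) ->
    nonminority c [set: 'I_n] b.
Proof.
move=> cardS xS.
have total (c : coloring n) col : valid_answer c S None ->
    num_colored c [set: 'I_n] col = l + num_colored c (~: S) col.
  move=> noS; rewrite -(balanced_num_colored col cardS noS) !num_coloredE.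
  by rewrite (bigID (mem S)) /=; congr (_ + _); apply: eq_bigl => y; rewrite !inE.
have inE_count (c : coloring n) :
    (forall y, y \notin S -> (c y == c x) = (y \in E)) ->
    num_colored c (~: S) (c x) = #|~: S :&: E|.
  move=> cE; apply: eq_card => y; rewrite !inE.
  by case yS: (y \in S) => //=; apply: cE; rewrite yS.
have cardSC := cardsC S; rewrite card_ord cardS in cardSC.
(* Name [x] if its color has at least half of the outside balls, and otherwise any outside ball not
   in [E], whose color is the opposite one. *)
have [leE|gtE] := leqP #|~: S| (2 * #|~: S :&: E|).
  exists x => c noS cE; rewrite nonminority_setT (total _ _ noS) inE_count //.
  lia.
have /card_gt0P[y] : 0 < #|~: S :\: E|.
  by move: (cardsID E (~: S)); lia.
rewrite !inE => /andP[yE yS].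
exists y => c noS cE; rewrite nonminority_setT (total _ _ noS).
have -> : c y = ~~ c x.
  by move: (cE y yS); rewrite (negPf yE); case: (c y); case: (c x).
by move: (num_coloredC c (~: S) (c x)); rewrite inE_count //; lia.
Qed.

(** * Adaptive strategies *)

(** [P] collects what the answers received so far reveal about the hidden coloring, so that
    strategies can be built one query at a time. *)
Definition solvable_knowing (q n : nat) (P : coloring n -> Prop) (k : nat) : Prop :=
  exists2 s : strategy n, queries_of_size q s &
    forall (c : coloring n) m b, P c -> run c s m b ->
      nonminority c [set: 'I_n] b /\ m <= k.

Lemma solvable_knowing_output q n (P : coloring n -> Prop) b :
  (forall c, P c -> nonminority c [set: 'I_n] b) -> solvable_knowing q P 0.
Proof.
move=> Pb; exists (Output b) => // c m b' Pc r; inversion r; subst.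
by split=> //; apply: Pb.
Qed.

Lemma solvable_knowing_query q n (P : coloring n -> Prop)
    (Q : {set 'I_n}) k :
  #|Q| = q ->
  (forall a, solvable_knowing q (fun c => P c /\ valid_answer c Q a) k) ->
  solvable_knowing q P k.+1.
Proof.
move=> cardQ solv.
pose good a s := queries_of_size q s /\
  (forall (c : coloring n) m b, P c /\ valid_answer c Q a -> run c s m b ->
    nonminority c [set: 'I_n] b /\ m <= k).
have /(@fin_all_exists (option 'I_n) (fun=> strategy n))[next nextP] :
    forall a, exists s, good a s.
  by move=> a; have [s sq sP] := solv a; exists s.
exists (Query Q next); first by split=> // a; case: (nextP a).
move=> c m b Pc r; inversion r as [|Q' next' a m' b' va ra]; subst.
have [_ nP] := nextP a; have [] := nP c m' b (conj Pc va) ra; split=> //; lia.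
Qed.

(** A fixed batch of queries is asked one by one, [P] absorbing each answer. This supplies the
    comparisons that follow a balanced query. *)
Lemma solvable_knowing_queries q n (P : coloring n -> Prop) (T : eqType)
    (Q : T -> {set 'I_n}) (s : seq T) :
  uniq s -> {in s, forall t, #|Q t| = q} ->
  (forall a : T -> answer n, exists b, forall c, P c ->
     {in s, forall t, valid_answer c (Q t) (a t)} -> nonminority c [set: 'I_n] b) ->
  solvable_knowing q P (size s).
Proof.
elim: s P => [|t s IH] P /=.
  move=> _ _ /(_ (fun=> None))[b bP].
  by apply: (@solvable_knowing_output _ _ _ b) => c Pc; apply: bP.
case/andP=> ts us cardQ ans; apply: (@solvable_knowing_query _ _ _ (Q t)).
  by apply: cardQ; rewrite mem_head.
move=> a0; apply: IH => // [u us'|a]; first by apply: cardQ; rewrite inE us' orbT.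
have [b bP] := ans (fun u => if u == t then a0 else a u).
exists b => c [Pc vt] va; apply: bP => // u; rewrite inE.
by case: eqP => [->|_] //= us'; apply: va.
Qed.

(** Loop invariant: [S] is the current query, [x] the ball added last, [U] the unseen balls; those
    outside both are discarded, all of a color [col] that may depend on [c]. Querying [S] leads
    either to [#|U|] comparisons with [x] or to a smaller [U]. *)
Lemma solvable_knowing_swap l n (S U : {set 'I_n}) (x : 'I_n) (P : coloring n -> Prop) :
  #|S| = 2 * l -> x \in S -> U \subset ~: S ->
  (forall c, P c -> exists col, l <= num_colored c (S :\ x) col /\
     forall z, z \notin S -> z \notin U -> c z = col) ->
  solvable_knowing (2 * l) P #|U|.+1.
Proof.
have [u] := ubnP #|U|.
elim: u => // u IH in S U x P * => ltU cardS xS US Pcol.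
apply: (@solvable_knowing_query _ _ _ S) => // -[b|]; last first.
  rewrite cardE.
  apply: (@solvable_knowing_queries _ _ _ _ (fun y => y |: S :\ x));
    first exact: enum_uniq.
    move=> y; rewrite mem_enum => yU.
    have yS : y \notin S by move/subsetP/(_ y yU): US; rewrite inE.
    by move: (cardsD1 x S); rewrite cardsU1 !inE (negPf yS) andbF xS cardS.
  move=> a; have [b bP] := balanced_nonminority [set y in U | a y == None] cardS xS.
  exists b => c [Pc noS] va; apply: bP => // y yS; rewrite inE.
  case yU: (y \in U) => /=.
    by apply: (valid_answer_swap cardS noS xS yS); apply: va; rewrite mem_enum.
  (* [S] is balanced and [S :\ x] already has [l] balls of color [col], so [x] has the other color
     and differs from every discarded ball. *)
  have [col [lcol cR]] := Pcol c Pc; rewrite (cR y yS) ?yU //.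
  have := balanced_num_colored col cardS noS.
  by rewrite (num_colored_setD1 _ _ xS) eq_sym; case: eqP => //=; lia.
(* At most [l] balls of [S] lack the color [col], so a majority ball must have it. *)
have bcol c : P c -> majority c S b ->
    b \in S /\ l < num_colored c S (c b) /\
    forall z, z \notin S -> z \notin U -> c z = c b.
  move=> Pc /majorityP[bS]; rewrite cardS => gtl; have [col [lcol cR]] := Pcol c Pc.
  suff cb : c b = col by split=> //; split; [lia | rewrite cb].
  move: gtl (num_coloredC c S col) (num_colored_setD1 c col xS).
  by rewrite cardS; case: (c b); case: col {cR} lcol => /=; lia.
have [U0|[y yU]] := set_0Vmem U.
  rewrite U0 cards0; apply: (@solvable_knowing_output _ _ _ b) => c [Pc maj].
  have [bS [gtl cR]] := bcol c Pc maj.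
  rewrite nonminority_setT num_coloredE (bigID (mem S)) /=.
  rewrite (eq_bigl (mem S)); last by move=> z; rewrite inE.
  rewrite -num_coloredE [X in _ + X](eq_bigr (fun=> 1)); last first.
    by move=> z; rewrite inE /= => zS; rewrite cR ?eqxx // U0 inE.
  rewrite (eq_bigl (mem (~: S))); last by move=> z; rewrite !inE.
  rewrite sum1_card; have := cardsC S; rewrite card_ord cardS; lia.
have yS : y \notin S by move/subsetP/(_ y yU): US; rewrite inE.
rewrite (cardsD1 y U) yU.
(* A ball outside [S] is no valid answer, so any strategy does in that branch. *)
case bS: (b \in S); last first.
  apply: (@solvable_knowing_query _ _ _ S) => // a; exists (Output b) => //.
  by move=> c m d [[_ /majorityP[]]]; rewrite bS.
have ySb : y \notin S :\ b by rewrite !inE (negPf yS) andbF.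
(* [b] joins the discarded balls and [y] takes the role of [x]: more than [l] balls of [S] have the
   color of [b], so at least [l] remain in [S :\ b]. *)
apply: (IH (y |: S :\ b) _ y).
- by move: ltU; rewrite (cardsD1 y U) yU.
- by move: (cardsD1 b S); rewrite cardsU1 ySb bS cardS.
- exact: setU11.
- apply/subsetP => z; rewrite !inE => /andP[zy zU]; rewrite (negPf zy) /=.
  by move/subsetP/(_ z zU): US; rewrite inE => /negPf->; rewrite andbF.
move=> c [Pc maj]; have [_ [gtl cR]] := bcol c Pc maj.
exists (c b); rewrite setU1K //; split.
  by move: gtl; rewrite (num_colored_setD1 _ _ bS) eqxx.
move=> z; rewrite !inE; case: (eqVneq z y) => //= zy.
by case: (eqVneq z b) => [->|zb] //=; apply: cR.
Qed.

Lemma adaptive_solvable_even l n :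
  1 <= l -> 2 * l <= n -> adaptive_solvable (2 * l) n (n - 2 * l + 1).
Proof.
move=> l1 leln.
have [S cardS] : exists S : {set 'I_n}, #|S| = 2 * l.
  have : (2 * l <= #|[set: 'I_n]|) by rewrite cardsT card_ord.
  case/card_geqP=> s [us <- _]; exists [set y in s].
  by rewrite cardsE; apply/card_uniqP.
have [x xS] : exists x : 'I_n, x \in S.
  by apply/card_gt0P; rewrite cardS muln_gt0.
have cardSC := cardsC S; rewrite card_ord cardS in cardSC.
have [s sq sP] : solvable_knowing (2 * l) (fun _ : coloring n => True) #|~: S|.+1.
  apply: (@solvable_knowing_swap _ _ S _ x) => // c _.
  (* With no ball discarded yet, any color occurring [l] times in [S :\ x] starts the invariant. *)
  have [|col lecol] := @exists_num_colored_ge _ c (S :\ x) l.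
    by rewrite -cardS (cardsD1 x S) xS.
  by exists col; split=> // z zS; rewrite inE zS.
exists s => // c m b r; have [] := sP c m b I r; split=> //; lia.
Qed.

(** * Non-adaptive strategies *)

Section Circle.

Variables m : nat.
Implicit Types i j k : nat.

Definition circ k : 'I_m.+1 := Ordinal (ltn_pmod k (ltn0Sn m)).

Lemma circ_mod i k : circ (circ i + k) = circ (i + k).
Proof. by apply: val_inj => /=; rewrite modnDml. Qed.

Lemma circ_eq i j k :
  j < m.+1 -> k < m.+1 -> (circ (i + j) == circ (i + k)) = (j == k).
Proof.
by move=> ltj ltk; rewrite -val_eqE /= eqn_modDl !modn_small.
Qed.

Lemma circ_shift_inj k : injective (fun i : 'I_m.+1 => circ (i + k)).
Proof.
move=> i j /eqP; rewrite -val_eqE /= eqn_modDr !modn_small // => /eqP.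
exact: val_inj.
Qed.

Lemma circ_onto i (y : 'I_m.+1) : exists2 k, k < m.+1 & y = circ (i + k).
Proof.
exists (circ (y + (m.+1 - i %% m.+1))); first by rewrite ltn_pmod.
apply: val_inj; rewrite /= modnDmr addnCA -modnDmr -(modnDml i) subnKC.
  by rewrite modnn addn0 modn_small.
by apply: ltnW; rewrite ltn_pmod.
Qed.

Definition arc i k : {set 'I_m.+1} := [set circ (i + j) | j : 'I_k].

Lemma mem_arc i k j : k <= m.+1 -> j < m.+1 -> (circ (i + j) \in arc i k) = (j < k).
Proof.
move=> lek ltj; apply/imsetP/idP => [[j' _ /eqP]|ltjk].
  by rewrite circ_eq // => [/eqP->|]; [|apply: leq_trans lek].
by exists (Ordinal ltjk).
Qed.

Lemma big_arc (F : 'I_m.+1 -> nat) i k :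
  k <= m.+1 -> \sum_(x in arc i k) F x = \sum_(j < k) F (circ (i + j)).
Proof.
move=> lek; rewrite big_imset //= => j j' _ _ /eqP.
rewrite circ_eq; try exact: leq_trans (ltn_ord _) lek.
by move/eqP/val_inj.
Qed.

Lemma card_arc i k : k <= m.+1 -> #|arc i k| = k.
Proof. by move=> lek; rewrite -sum1_card big_arc // sum1_card card_ord. Qed.

Lemma arcS_mod i k : arc (circ i).+1 k = arc i.+1 k.
Proof. by apply: eq_imset => j; rewrite !addSnnS circ_mod. Qed.

Lemma circ_notin_arcS i k : k < m.+1 -> circ i \notin arc i.+1 k.
Proof.
move=> ltk; apply/imsetP => -[j _ /eqP].
by rewrite addSnnS -[X in circ X == _]addn0 circ_eq //; move: (ltn_ord j); lia.
Qed.

Lemma arcSl i k : arc i k.+1 = circ i |: arc i.+1 k.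
Proof.
apply/setP => y; rewrite !inE; apply/imsetP/orP.
  case=> -[[|j] ltj] _ -> /=; first by left; rewrite addn0.
  by right; apply/imsetP; exists (Ordinal (ltj : j < k)) => //=; rewrite addnS.
case=> [/eqP->|/imsetP[j _ ->]]; first by exists ord0; rewrite //= addn0.
by exists (lift ord0 j); rewrite //= /bump /= add1n addnS.
Qed.

Lemma arcSr i k : arc i k.+1 = circ (i + k) |: arc i k.
Proof.
apply/setP => y; rewrite !inE; apply/imsetP/orP.
  case=> j _ ->; have [ltj|] := ltnP j k.
    by right; apply/imsetP; exists (Ordinal ltj).
  by move=> lej; left; rewrite (_ : j = k :> nat) //; move: (ltn_ord j); lia.
case=> [/eqP->|/imsetP[j _ ->]]; first by exists ord_max.
by exists (widen_ord (leqnSn k) j).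
Qed.

(** Double counting: each ball lies in exactly [k] of the [m.+1] arcs of length [k]. *)
Lemma sum_num_colored_arc (c : coloring m.+1) col k :
  k <= m.+1 ->
  \sum_(i < m.+1) num_colored c (arc i.+1 k) col =
  k * num_colored c [set: 'I_m.+1] col.
Proof.
move=> lek.
under eq_bigr => i _ do rewrite num_coloredE big_arc //.
rewrite exchange_big /= -[k in RHS]card_ord -sum_nat_const.
apply: eq_bigr => j _; rewrite num_coloredE.
rewrite [RHS](reindex_inj (@circ_shift_inj j.+1)) /=.
by apply: eq_big => [i|i _]; rewrite ?inE // addSnnS.
Qed.

End Circle.

(** * The non-adaptive bound *)

Lemma num_colored_sub n (c : coloring n) (S T : {set 'I_n}) col :
  S \subset T -> num_colored c S col <= num_colored c T col.
Proof.
move=> ST; apply/subset_leq_card/subsetP => x; rewrite !inE => /andP[xS ->].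
by rewrite (subsetP ST).
Qed.

Lemma nonadaptive_solvable_fin q n (T : finType) (Q : T -> {set 'I_n}) :
  (forall t, #|Q t| = q) ->
  (forall a : T -> answer n, exists b, forall c : coloring n,
     (forall t, valid_answer c (Q t) (a t)) -> nonminority c [set: 'I_n] b) ->
  nonadaptive_solvable q n #|T|.
Proof.
move=> cardQ ans; exists (fun i => Q (enum_val i)) => [i|a]; first exact: cardQ.
have [b bP] := ans (fun t => a (enum_rank t)).
by exists b => c va; apply: bP => t; have := va (enum_rank t); rewrite enum_rankK.
Qed.

Lemma nonadaptive_solvable_even l n :
  1 <= l -> 2 * l < n -> nonadaptive_solvable (2 * l) n (n * (n - 2 * l)).
Proof.
case: n => // m; case: l => // l _ ltl; set q := (2 * l).+1.
have q1 : 2 * l.+1 = q.+1 by rewrite /q; lia.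
rewrite q1 in ltl *.
(* The arc of [q.+1] balls from [i] exchanges its first ball for the [j]-th ball after its end. For
   [j = 0] this is the next arc, starting at [i.+1]. *)
pose Q (t : 'I_m.+1 * 'I_(m.+1 - q.+1)) := circ m (t.1 + q.+1 + t.2) |: arc m t.1.+1 q.
have ltj (j : 'I_(m.+1 - q.+1)) : q.+1 + j < m.+1 by move: (ltn_ord j); lia.
have -> : m.+1 * (m.+1 - q.+1) = #|{: 'I_m.+1 * 'I_(m.+1 - q.+1)}|.
  by rewrite card_prod !card_ord.
apply: (@nonadaptive_solvable_fin _ _ _ Q) => [[i j]|a].
  rewrite /Q /= cardsU1 card_arc ?(ltnW (ltnW ltl)) //.
  have -> : i + q.+1 + j = i.+1 + (q + j) by lia.
  by rewrite mem_arc; [rewrite -leqNgt leq_addr; lia | lia | move: (ltj j); lia].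
have j0lt : 0 < m.+1 - q.+1 by lia.
pose j0 := Ordinal j0lt.
have Q0 i : Q (i, j0) = arc m i.+1 q.+1.
  by rewrite /Q /= arcSr addn0 addnS addSn.
have cardarc i : #|arc m i q.+1| = 2 * l.+1 by rewrite card_arc ?q1 //; lia.
have [/existsP[i /eqP ai]|/existsPn aS] := boolP [exists i, a (i, j0) == None].
  have xS : circ m i.+1 \in arc m i.+1 q.+1 by rewrite arcSl setU11.
  (* The swaps in the balanced arc are the queries with first index [circ m i.+1]; reducing the
     index matters when [i] is the last position. *)
  pose E := [set circ m (i.+1 + q.+1 + j) |
    j : 'I_(m.+1 - q.+1) & a (circ m i.+1, j) == None].
  have [b bP] := balanced_nonminority E (cardarc i.+1) xS.
  exists b => c va; have noS := va (i, j0); rewrite ai Q0 in noS.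
  apply: bP => // y yS; have [k ltk yk] := circ_onto i.+1 y.
  have lek : q.+1 <= k by rewrite leqNgt -(mem_arc i.+1 (ltnW ltl) ltk) -yk.
  have ltk' : k - q.+1 < m.+1 - q.+1 by lia.
  pose j := Ordinal ltk'.
  have yj : y = circ m (i.+1 + q.+1 + j) by rewrite yk /=; congr (circ m _); lia.
  have -> : (y \in E) = (a (circ m i.+1, j) == None).
    apply/imsetP/idP => [[j']|aj]; last by exists j; rewrite ?inE.
    rewrite inE => aj' /eqP; rewrite yj -!addnA circ_eq ?ltj // eqn_add2l.
    by move=> /eqP/val_inj->.
  apply: (valid_answer_swap (cardarc i.+1) noS xS yS).
  have -> : arc m i.+1 q.+1 :\ circ m i.+1 = arc m i.+2 q.
    by rewrite arcSl setU1K // circ_notin_arcS //; lia.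
  have := va (circ m i.+1, j).
  by rewrite /Q [_.1]/= -addnA circ_mod arcS_mod addnA -yj.
have [b0 ab0] : exists b, a (ord0, j0) = Some b.
  by have := aS ord0; case: (a _) => // b _; exists b.
exists b0 => c va.
(* Consecutive arcs share all but one ball, so the next arc keeps at least [l.+1] balls of the
   color, half of its size. As it has a majority, the color stays the same. *)
have gtl k : k < m.+1 -> l.+1 < num_colored c (arc m k.+1 q.+1) (c b0).
  elim: k => [|k IH] ltk.
    have := va (ord0, j0); rewrite ab0 Q0 => /majorityP[_].
    by rewrite cardarc ltn_pmul2l.
  have := va (Ordinal ltk, j0); have := aS (Ordinal ltk).
  case: (a _) => // b _; rewrite Q0 /= => /majorityP[_]; rewrite cardarc.
  have := IH (ltnW ltk).
  have := num_coloredC c (arc m k.+2 q.+1) (c b0); rewrite cardarc.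
  have : num_colored c (arc m k.+2 q) (c b0) <= num_colored c (arc m k.+2 q.+1) (c b0).
    by apply: num_colored_sub; rewrite arcSr subsetUr.
  rewrite (arcSl m k.+1) num_colored_setU1; last first.
    by rewrite circ_notin_arcS //; lia.
  by case: (c b); case: (c b0) => /=; lia.
rewrite nonminority_setT.
(* Averaging: the [m.+1] arcs have at least [l.+2] balls of the color each, and every such ball is
   counted [2 * l.+1] times. *)
have := sum_num_colored_arc c (c b0) (ltnW ltl).
have : \sum_(i < m.+1) l.+2 <= \sum_(i < m.+1) num_colored c (arc m i.+1 q.+1) (c b0).
  by apply: leq_sum => i _; apply: gtl.
rewrite sum_nat_const card_ord -q1.
nia.
Qed.

Unset Implicit Arguments.

Theorem theorem6 (l n : nat) (hl : 1 <= l) (hn : 2 * l <= n) :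
  (l = 1 \/ 2 * l < n ->
     exists2 k : nat, is_N (2 * l) n k & k <= n * (n - 2 * l)) /\
  (exists2 a : nat, is_A (2 * l) n a & a <= n - 2 * l + 1).
Proof.
split; last exact/exists_is_minimum/adaptive_solvable_even.
move=> hln; apply: exists_is_minimum.
(* For [n = 2l] the bound allows no query; this succeeds for two balls, where any ball alone is half
   of the set. *)
have [ltn|gen] := ltnP (2 * l) n; first exact: nonadaptive_solvable_even.
have {hln} l1 : l = 1 by case: hln => //; lia.
have n2 : n = 2 by lia.
rewrite l1 n2 [X in nonadaptive_solvable _ _ X](_ : _ = 0) //.
exists (fun=> set0) => [[]|a] //.
exists ord0 => c _; rewrite nonminority_setT.
have : 0 < num_colored c [set: 'I_2] (c ord0).
  by apply/card_gt0P; exists ord0; rewrite !inE /=.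
lia.
Qed.
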